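(* Let $H\leq F_m$ be a non-trivial finitely generated subgroup, and let $\mathcal{A}_H=\mathcal{A}_{\widehat\Delta_H}\times\mathcal{A}_{F_m}$. Then $L(\mathcal{A}_H)=L_H$.
   Context: Automata. An admissible path of a finite automaton is a directed path (possibly of length $0$) in its Moore (transition) diagram from an initial state to a final state; $L(\mathcal{A})$ is the set of labels of admissible paths of $\mathcal{A}$. Free group and core. $A=\{a_1,\dots,a_m\}$ is a fixed basis of $F_m$ and $\Sigma=A\cup A^{-1}$. A word over $\Sigma$ is reduced if it has no subword $xx^{-1}$, $x\in\Sigma$. $L_H\subseteq\Sigma^*$ is the set of reduced words (including the empty word) representing elements of $H$. The extended Schreier graph $\widehat\Gamma$ of $H$ has as vertices the right cosets $Hg$, $g\in F_m$, with exactly one edge labelled $x$ from $Hg$ to $Hgx$ for every vertex $Hg$ and every $x\in\Sigma$. The root is $v_0=H$. The extended core $\widehat\Delta_H=(\widehat V,\widehat E,\widehat\mu)$ is the subgraph of $\widehat\Gamma$ consisting of $v_0$ and all vertices and edges lying on closed paths based at $v_0$ with reduced label; it is finite when $H$ is finitely generated. The automata. $\mathcal{A}_{\widehat\Delta_H}$ has Moore diagram $\widehat\Delta_H$ and $v_0$ as its only initial and only final state. $\mathcal{A}_{F_m}$ has states $Q_{F_m}=\{q_0\}\cup\{q_i^{\epsilon}\mid a_i^{\epsilon}\in\Sigma\}$, all of them final, initial state $q_0$, and transitions $\delta_{F_m}(q_0,a_j^{\epsilon'})=q_j^{\epsilon'}$ for all $a_j^{\epsilon'}\in\Sigma$ and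 $\delta_{F_m}(q_i^{\epsilon},a_j^{\epsilon'})=q_j^{\epsilon'}$ if $a_i^{\epsilon}\neq(a_j^{\epsilon'})^{-1}$ (undefined otherwise). $\mathcal{A}_H=\mathcal{A}_{\widehat\Delta_H}\times\mathcal{A}_{F_m}$ has states $\widehat V\times Q_{F_m}$, initial state $(v_0,q_0)$, final states $\{v_0\}\times Q_{F_m}$, and on reading $x$ moves from $(v,q)$ to $(\delta_{\widehat\Delta_H}(v,x),\delta_{F_m}(q,x))$ when both components are defined, being undefined otherwise. *)

(* Defs.v *)
From HB Require Import structures.
From mathcomp Require Import all_boot all_classical.

Set Implicit Arguments.
Unset Strict Implicit.
Unset Printing Implicit Defensive.

Local Open Scope group_scope.
Local Open Scope classical_set_scope.

(* The alphabet Sigma: the pair (i, false) stands for a_i and the pair         *)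
(* (i, true) for its inverse.                                                  *)
Definition letter (m : nat) : finType := ('I_m * bool)%type.

Definition linv m (x : letter m) : letter m := (x.1, ~~ x.2).

Definition reduced m (w : seq (letter m)) : bool :=
  [forall x, ~~ infix [:: x; linv x] w].

(* The free group on a_0, ..., a_(m-1): reduced words, multiplied by           *)
(* concatenation followed by free cancellation. [push x w] is the reduced form *)
(* of x :: w when w is reduced.                                                *)
Record free_group (m : nat) := FreeGroup {
  fword :> seq (letter m);
  _ : reduced fword }.

HB.instance Definition _ m := [isSub for @fword m].
HB.instance Definition _ m := [Choice of free_group m by <:].

Section FreeGroup.
Variable m : nat.
Implicit Types (x y : letter m) (u v w : seq (letter m)) (g h : free_group m).

Definition push x w :=
  if w is y :: w' then if y == linv x then w' else x :: w else [:: x].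

Lemma linvK : involutive (@linv m).
Proof. by case=> i b; rewrite /linv /= negbK. Qed.

Lemma reducedE w : reduced w = sorted (fun x y => y != linv x) w.
Proof.
rewrite /reduced; elim: w => [|z w IH]; first exact/forallP.
have IH1 : [forall x, ~~ infix [:: x; linv x] (z :: w)] =
    [forall x, ~~ prefix [:: x; linv x] (z :: w)] && reduced w.
  apply/forallP/andP => [H|[/forallP H1 /forallP H2] x]; last first.
    by rewrite infix_consl negb_or H1 H2.
  by split; apply/forallP => x; have := H x; rewrite infix_consl negb_or => /andP[].
rewrite IH1 [reduced w]IH {IH IH1}; case: w => [|y w] /=.
  by rewrite andbT; apply/forallP => x /=; rewrite andbF.
congr (_ && _); apply/forallP/idP => [/(_ z)|yz x].
  by rewrite eqxx prefix0s andbT /= eq_sym.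
by rewrite prefix0s andbT; apply: contra yz => /andP[/eqP<- /eqP<-].
Qed.

Lemma reduced_nil : @reduced m [::].
Proof. by rewrite reducedE. Qed.

Lemma reduced_push x w : reduced w -> reduced (push x w).
Proof.
rewrite !reducedE; case: w => [//|y w] /= yw.
by case: ifP => [_|/negbT yx] /=; [exact: path_sorted yw | rewrite yx].
Qed.

Lemma pushK x w : reduced w -> push x (push (linv x) w) = w.
Proof.
rewrite reducedE; case: w => [|y w] /=; first by rewrite eqxx.
rewrite linvK; case: eqP => [->|_ _] /=; last by rewrite eqxx.
by case: w => [|z w] //= /andP[/negbTE->].
Qed.

Lemma pushVK x w : reduced w -> push (linv x) (push x w) = w.
Proof. by move=> rw; rewrite -{2}[x]linvK pushK. Qed.

Definition word_mul u v := foldr push v u.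

Lemma reduced_mul u v : reduced v -> reduced (word_mul u v).
Proof. by move=> rv; elim: u => //= x u; apply: reduced_push. Qed.

Lemma word_mul_push x u v : reduced v ->
  word_mul (push x u) v = push x (word_mul u v).
Proof.
move=> rv; case: u => [//|y u] /=; case: eqP => // ->.
by rewrite pushK// reduced_mul.
Qed.

Lemma word_mulA u v w : reduced w ->
  word_mul (word_mul u v) w = word_mul u (word_mul v w).
Proof. by move=> rw; elim: u => //= x u <-; rewrite word_mul_push. Qed.

Lemma word_muls0 u : reduced u -> word_mul u [::] = u.
Proof.
rewrite reducedE; elim: u => //= x u IH xu; rewrite IH ?(path_sorted xu)//.
by case: u xu {IH} => [//|y u] /= /andP[/negbTE->].
Qed.

Definition word_inv u := rev (map (@linv m) u).

Lemma reduced_inv u : reduced u -> reduced (word_inv u).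
Proof.
rewrite !reducedE /word_inv rev_sorted sorted_map; apply: sub_sorted => x y yx.
suff: linv x != linv (linv y) by [].
by rewrite linvK eq_sym.
Qed.

Lemma word_mulV u v : reduced v -> word_mul (word_inv u) (word_mul u v) = v.
Proof.
move=> rv; elim: u => //= x u IH.
rewrite /word_inv/= rev_cons -cats1 {1}/word_mul foldr_cat /=.
by rewrite pushVK ?reduced_mul.
Qed.

Lemma word_invK : involutive word_inv.
Proof.
move=> u; rewrite /word_inv map_rev revK -map_comp -[RHS]map_id.
by apply: eq_map => x /=; rewrite linvK.
Qed.

Definition fg_mul g h : free_group m := FreeGroup (reduced_mul g (valP h)).
Definition fg_one : free_group m := FreeGroup reduced_nil.
Definition fg_inv g : free_group m := FreeGroup (reduced_inv (valP g)).

Lemma fg_mulA : associative fg_mul.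
Proof. by move=> g h k; apply: val_inj; rewrite /= word_mulA ?(valP k). Qed.

Lemma fg_mul1 : left_id fg_one fg_mul.
Proof. by move=> g; apply: val_inj. Qed.

Lemma fg_mulr1 : right_id fg_one fg_mul.
Proof. by move=> g; apply: val_inj; rewrite /= word_muls0 ?(valP g). Qed.

Lemma fg_mulV : left_inverse fg_one fg_inv fg_mul.
Proof.
move=> g; apply: val_inj => /=.
by rewrite -{2}[fword g]word_muls0 ?(valP g)// word_mulV ?reduced_nil.
Qed.

Lemma fg_mulrV : right_inverse fg_one fg_inv fg_mul.
Proof.
move=> g; rewrite -{1}[g](_ : fg_inv (fg_inv g) = g) ?fg_mulV//.
by apply: val_inj; rewrite /= word_invK.
Qed.

End FreeGroup.

HB.instance Definition _ m := isGroup.Build (free_group m)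
  (@fg_mulA m) (@fg_mul1 m) (@fg_mulr1 m) (@fg_mulV m) (@fg_mulrV m).

Lemma reduced_letter m (x : letter m) : reduced [:: x].
Proof. by rewrite reducedE. Qed.

Definition basis m (i : 'I_m) : free_group m :=
  FreeGroup (reduced_letter (i, false)).

Definition letter_val m (x : letter m) : free_group m :=
  if x.2 then (basis x.1)^-1 else basis x.1.

Definition word_val m (w : seq (letter m)) : free_group m :=
  \prod_(x <- w) letter_val x.

Definition is_subgroup (G : groupType) (H : set G) : Prop :=
  group_closed [in H].

Definition finitely_generated (G : groupType) (H : set G) : Prop :=
  exists s : seq G, H = smallest (@is_subgroup G) [set` s].

Definition reduced_words m (H : set (free_group m)) : set (seq (letter m)) :=
  [set w | reduced w /\ H (word_val w)].

(* Directed graphs with edges labelled in X; an edge is the triple (source,    *)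
(* label, target).                                                             *)
Record lgraph (V X : Type) := LGraph {
  vertices : set V;
  edges : set (V * X * V) }.

Fixpoint is_path V X (G : lgraph V X) (u : V) (p : seq (V * X * V)) (v : V) :
    Prop :=
  if p is e :: p' then [/\ edges G e, e.1.1 = u & is_path G e.2 p' v]
  else vertices G u /\ u = v.

Definition path_label V X (p : seq (V * X * V)) : seq X :=
  [seq e.1.2 | e <- p].

(* The state set is allowed to be infinite.                                *)
Record automaton (Q X : Type) := Automaton {
  moore : lgraph Q X;
  initial : set Q;
  final : set Q }.

Definition language Q X (A : automaton Q X) : set (seq X) :=
  [set w | exists u v p, [/\ initial A u, final A v,
    is_path (moore A) u p v & w = path_label p]].

Definition prod_automaton Q1 Q2 X (A : automaton Q1 X) (B : automaton Q2 X) :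
    automaton (Q1 * Q2) X :=
  {| moore :=
       {| vertices := vertices (moore A) `*` vertices (moore B);
          edges := [set e | let: ((u, q), x, (u', q')) := e in
            edges (moore A) (u, x, u') /\ edges (moore B) (q, x, q')] |};
     initial := initial A `*` initial B;
     final := final A `*` final B |}.

Definition right_coset (G : groupType) (H : set G) (g : G) : set G :=
  [set h * g | h in H].

Section Schreier.
Variables (m : nat) (H : set (free_group m)).

Definition schreier : lgraph (set (free_group m)) (letter m) :=
  {| vertices := [set right_coset H g | g in [set: free_group m]];
     edges := [set (right_coset H g, x, right_coset H (g * letter_val x)) |
               g in [set: free_group m] & x in [set: letter m]] |}.

Definition closed_reduced_path (p : seq (set (free_group m) * letter m *
    set (free_group m))) : Prop :=
  is_path schreier H p H /\ reduced (path_label p).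

Definition extended_core : lgraph (set (free_group m)) (letter m) :=
  {| vertices := H |` [set v | exists2 p, closed_reduced_path p &
                                 v \in H :: [seq e.2 | e <- p]];
     edges := [set e | exists2 p, closed_reduced_path p & e \in p] |}.

Definition core_automaton : automaton (set (free_group m)) (letter m) :=
  {| moore := extended_core; initial := [set H]; final := [set H] |}.

End Schreier.

Inductive reduced_state (m : nat) :=
  | q_start
  | q_letter of letter m.
Arguments q_start {m}.

Definition reduced_delta m (q : reduced_state m) (x : letter m) :
    option (reduced_state m) :=
  match q with
  | q_start => Some (q_letter x)
  | q_letter y => if y != linv x then Some (q_letter x) else None
  end.

Definition reduced_automaton m : automaton (reduced_state m) (letter m) :=
  {| moore :=
       {| vertices := [set: reduced_state m];
          edges := [set e | reduced_delta e.1.1 e.1.2 = Some e.2] |};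
     initial := [set q_start];
     final := [set: reduced_state m] |}.

Definition subgroup_automaton m (H : set (free_group m)) :
    automaton (set (free_group m) * reduced_state m) (letter m) :=
  prod_automaton (core_automaton H) (reduced_automaton m).

(* Main.v *)
(* The language of a product automaton is the intersection of the two          *)
(* languages. The second factor reads exactly the reduced words. In the        *)
(* Schreier graph the edge labelled x translates a coset by x, so a path from  *)
(* H to H labelled w exists iff H w = H, i.e. iff w represents an element of H; *)
(* when w is reduced this path is by definition inside the extended core.      *)
Require Import Defs.
From mathcomp Require Import all_boot all_classical.

Local Open Scope classical_set_scope.

(** By [language_prod] and [language_reduced_automaton] it remains to decide which reduced words
    label a closed path at $H$ in the extended core. Reading $w$ in the Schreier graph translates
    cosets by $w$ ([schreier_path_target]), so a closed path gives $Hw=H$ and hence $w\in H$.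
    Conversely, for $w\in H$ the path lifting $w$ from $H$ ([schreier_path_exists]) closes up, and
    it lies in the core because $w$ is reduced. *)

Lemma language_prod Q1 Q2 X (A : automaton Q1 X) (B : automaton Q2 X) :
  language (prod_automaton A B) = language A `&` language B.
Proof.
apply/seteqP; split=> w.
  case=> [[u1 u2] [[v1 v2] [p [[/= iu1 iu2] [/= fv1 fv2] pP ->]]]].
  pose p1 := [seq (e.1.1.1, e.1.2, e.2.1) | e <- p].
  pose p2 := [seq (e.1.1.2, e.1.2, e.2.2) | e <- p].
  suff [P1 P2] : is_path (moore A) u1 p1 v1 /\ is_path (moore B) u2 p2 v2.
    split; [exists u1, v1, p1|exists u2, v2, p2]; split=> //;
      by rewrite /path_label -map_comp.
  rewrite {}/p1 {}/p2; elim: p u1 u2 pP {iu1 iu2} => [|e p IH] u1 u2 /=.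
    by case=> -[? ?] [<- <-].
  by case: e => [[[a1 a2] x] [b1 b2]] /= [[e1 e2] [<- <-] /IH[]].
case=> -[u1 [v1 [p1 [iu1 fv1 P1 w1]]]] [u2 [v2 [p2 [iu2 fv2 P2 w2]]]].
suff [p P wp] : exists2 p, is_path (moore (prod_automaton A B)) (u1, u2) p
    (v1, v2) & w = path_label p.
  by exists (u1, u2), (v1, v2), p; split.
(* The two paths are zipped edge by edge; equal labels force equal lengths. *)
elim: p1 p2 w u1 u2 P1 P2 w1 w2 {iu1 iu2} => [|e1 p1 IH] [|e2 p2] w u1 u2 /=.
- by case=> ? <- [? <-] -> _; exists [::].
- by move=> _ _ ->.
- by move=> _ _ ->.
case: e1 e2 => [[a1 x1] b1] [[a2 x2] b2] /= [E1 <- P1] [E2 <- P2] ->.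
case=> x12 lab; have [p P ->] := IH _ _ _ _ P1 P2 erefl lab.
by exists (((a1, a2), x1, (b1, b2)) :: p); rewrite -?x12 // in E2 *.
Qed.

(** The state [q_letter y] remembers the last letter read, and a word is reduced as soon as each
    pair of adjacent letters is. *)
Lemma reduced_automaton_path m (y : letter m) (w : seq (letter m)) :
  (exists v p, is_path (moore (reduced_automaton m)) (q_letter y) p v /\
               w = path_label p) <->
  reduced (y :: w).
Proof.
rewrite reducedE /=; elim: w y => [|x w IH] y /=.
  by split=> // _; exists (q_letter y), [::].
have linvE : (y == linv x) = (x == linv y).
  by apply/eqP/eqP => ->; rewrite linvK.
split=> [[v [[|[[q x'] q'] p] [//= [dq qy P] [xx' wp]]]]|/andP[yx /IH[v [p [P ->]]]]].
  subst q x'; move: dq; rewrite /= linvE; case: eqP => //= _ [q'E].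
  by apply/IH; exists v, p; rewrite q'E.
exists v, ((q_letter y, x, q_letter x) :: p); split=> //=; split=> //=.
by rewrite linvE yx.
Qed.

Lemma language_reduced_automaton m :
  language (reduced_automaton m) = [set w | reduced w].
Proof.
apply/seteqP; split=> w.
  case=> _ [v [[|[[q x] q'] p] [-> _ P ->]]] /=; first exact: reduced_nil.
  case: P => /= dq qE P; subst q; case: dq => q'E.
  by apply/reduced_automaton_path; exists v, p; rewrite q'E.
case: w => [_|x w /reduced_automaton_path[v [p [P ->]]]].
  by exists q_start, q_start, [::].
by exists q_start, v, ((q_start, x, q_letter x) :: p).
Qed.

(** Moves paths both ways between the core and the Schreier graph. Only the endpoint needs a vertex
    condition, since [is_path] tests [vertices] at the end of the path alone. *)
Lemma is_path_sub (V X : eqType) (G G' : lgraph V X) u p v :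
  is_path G u p v -> vertices G' v ->
  {in p, forall e, edges G e -> edges G' e} -> is_path G' u p v.
Proof.
move=> P G'v; elim: p u P => [|e p IH] u /=; first by case=> _ ->.
move=> [Ge eu P] GG'; split=> //; first by apply: GG'; rewrite ?mem_head.
by apply: IH => // f fp; apply: GG'; rewrite inE fp orbT.
Qed.

Section SchreierPaths.
Variables (m : nat) (H : set (free_group m)).
Local Open Scope group_scope.

Lemma right_cosetM (g h : free_group m) :
  right_coset H (g * h) = [set y * h | y in right_coset H g].
Proof.
by rewrite /right_coset image_comp; apply: eq_imagel => y _ /=; rewrite mulgA.
Qed.

Lemma right_coset1 : right_coset H 1 = H.
Proof.
by rewrite -[RHS]image_id; apply: eq_imagel => y _; rewrite mulg1.
Qed.

Lemma right_coset_id h : is_subgroup H -> H h -> right_coset H h = H.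
Proof.
move=> sH Hh; have HM x y : H x -> H y -> H (x * y).
  by move=> Hx Hy; apply/set_mem/(group_closedM sH); rewrite inE.
have HV x : H x -> H x^-1.
  by move=> Hx; apply/set_mem/(group_closedV sH); rewrite inE.
apply/seteqP; split=> [_ [y Hy <-]|y Hy]; first exact: HM.
by exists (y * h^-1); [exact/HM/HV | rewrite mulgVK].
Qed.

(** An edge labelled $x$ sends $Hg$ to $Hgx=(Hg)x$, whichever representative $g$ is chosen. *)
Lemma schreier_path_target u p v : is_path (schreier H) u p v ->
  v = [set y * word_val (path_label p) | y in u].
Proof.
elim: p u => [|e p IH] u /=.
  case=> _ <-; rewrite /word_val big_nil -[LHS]image_id.
  by apply: eq_imagel => y _; rewrite mulg1.
case=> -[g _ [x _ <-]] /= <- /IH ->.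
rewrite right_cosetM image_comp; apply: eq_imagel => y _ /=.
by rewrite /word_val big_cons mulgA.
Qed.

Lemma schreier_path_exists g w : exists2 p,
  is_path (schreier H) (right_coset H g) p (right_coset H (g * word_val w)) &
  path_label p = w.
Proof.
elim: w g => [|x w IH] g.
  exists [::] => //=; rewrite /word_val big_nil mulg1; split=> //.
  by exists g.
have [p P pw] := IH (g * letter_val x).
exists ((right_coset H g, x, right_coset H (g * letter_val x)) :: p) => /=.
  split=> //; first by exists g => //; exists x.
  by rewrite /word_val big_cons mulgA.
by rewrite pw.
Qed.

End SchreierPaths.

Lemma schreier_core_edge m (H : set (free_group m)) e :
  edges (extended_core H) e -> edges (schreier H) e.
Proof.
case=> p [P _]; elim: p (X in is_path _ X) P => [//|f p IH] u /= [Ef _ P].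
by rewrite inE => /orP[/eqP-> //|]; apply: IH P.
Qed.

Theorem proposition5p3 (m : nat) (H : set (free_group m)) :
  is_subgroup H -> H <> [set 1%g] -> finitely_generated H ->
  language (subgroup_automaton H) = reduced_words H.
Proof.
move=> sH _ _; rewrite language_prod language_reduced_automaton.
apply/seteqP; split=> w.
  case=> -[_ [_ [p [/= -> -> P wp]]]] rw; split=> //.
  have /schreier_path_target HE : is_path (schreier H) H p H.
    apply: is_path_sub P _ _ => [|e _]; last exact: schreier_core_edge.
    by exists 1%g => //; exact: right_coset1.
  (* Since $H=Hw$ and $1\in H$, the element $1\cdot w$ lies in $H$. *)
  rewrite HE wp; exists 1%g; last by rewrite mul1g.
  by apply/set_mem; case: sH.
case=> rw Hw; split=> //; have [p] := schreier_path_exists m H 1%g w.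
rewrite mul1g right_coset1 right_coset_id// => P wp.
exists H, H, p; split=> //; apply: (is_path_sub _ _ _ _ _ _ _ P); first by left.
(* The path [p] itself is the closed reduced path that puts its edges in the core. *)
by move=> e ep _; exists p => //; split; rewrite ?wp.
Qed.
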